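(* Let $V$ be a finite-dimensional complex vector space and let $\mathbf{X} = (X_n)_{n=1}^\infty$ with $X_n \subset M_n(V)$ for $n \ge 1$. (a) If $x \in M_n(V)$ belongs to the matrix convex hull of $\mathbf{X}$, then it is a matrix convex combination of points of $\mathbf{X}$ of length at most $n^2 (2 \dim(V) + 1)$. (b) Suppose that $V$ has a real structure and that $X_n \subset M_n(V)_{sa}$ for $n \ge 1$. If $x \in M_n(V)$ belongs to the matrix convex hull of $\mathbf{X}$, then it is a matrix convex combination of points of $\mathbf{X}$ of length at most $n^2(\dim(V) + 1)$.
   Context: $M_n(V) = M_n \otimes V$ is the space of $n\times n$ matrices over $V$; scalar matrices of suitable sizes multiply elements of $M_n(V)$ from the left and right. $M_{k,n}$ denotes the complex $k \times n$ matrices. A matrix convex combination of elements $x_i \in M_{n_i}(V)$, $1 \le i \le s$, is an expression $x = \sum_{i=1}^s \gamma_i^* x_i \gamma_i \in M_n(V)$ with $\gamma_i \in M_{n_i,n}$ and $\sum_{i=1}^s \gamma_i^*\gamma_i = I_n$; the integer $s$ is its length (some $x_i$ may be repeated, and repetitions count towards the length). $\mathbf{X}$ is matrix convex if it is closed under matrix convex combinations of its elements. The matrix convex hull of $\mathbf{X}$ is the smallest matrix convex set containing $\mathbf{X}$, equivalently the set of all matrix convex combinations of elements of $\mathbf{X}$. A real structure on $V$ is a conjugate linear involution $*$ on $V$; it induces a real structure on $M_n(V)$ by $[v_{ij}]^* = [v_{ji}^*]$, and $M_n(V)_{sa} = \{x \in M_n(V) : x = x^*\}$. $\dim(V)$ is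 the complex dimension. *)

(* Defs.v *)
From mathcomp Require Export all_boot all_order all_algebra.
From mathcomp Require Export complex.
From mathcomp Require Export classical_sets reals.

Set Implicit Arguments.
Unset Strict Implicit.
Unset Printing Implicit Defensive.

Import GRing.Theory Num.Theory.
Local Open Scope classical_set_scope.
Local Open Scope ring_scope.
Local Open Scope sesquilinear_scope.

Definition lmulmxv (R : realType) (V : vectType R[i]) (m n p : nat)
    (A : 'M[R[i]]_(m, n)) (x : 'M[V]_(n, p)) : 'M[V]_(m, p) :=
  \matrix_(i, j) \sum_k A i k *: x k j.

Definition rmulmxv (R : realType) (V : vectType R[i]) (m n p : nat)
    (x : 'M[V]_(m, n)) (A : 'M[R[i]]_(n, p)) : 'M[V]_(m, p) :=
  \matrix_(i, j) \sum_k A k j *: x i k.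

Definition compress (R : realType) (V : vectType R[i]) (m n : nat)
    (g : 'M[R[i]]_(m, n)) (x : 'M[V]_m) : 'M[V]_n :=
  rmulmxv (lmulmxv (g ^t*) x) g.

(* Matrix sizes are positive: the component of index n is the set of matrices
   of size n.+1. *)
Definition mxfamily (R : realType) (V : vectType R[i]) : Type :=
  forall n : nat, set 'M[V]_n.+1.

(* The index set 'I_s makes s the length counted with repetitions: the y i need
   not be distinct. *)
Definition mxconv_comb (R : realType) (V : vectType R[i]) (X : mxfamily V)
    (s n : nat) (x : 'M[V]_n.+1) : Prop :=
  exists (m : 'I_s -> nat) (y : forall i, 'M[V]_((m i).+1))
         (g : forall i, 'M[R[i]]_((m i).+1, n.+1)),
    [/\ forall i, X (m i) (y i),
        \sum_i (g i) ^t* *m g i = 1%:M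
      & x = \sum_i compress (g i) (y i)].

Definition matrix_convex (R : realType) (V : vectType R[i])
    (X : mxfamily V) : Prop :=
  forall (s n : nat) (x : 'M[V]_n.+1), mxconv_comb X s x -> X n x.

Definition mxconv_hull (R : realType) (V : vectType R[i])
    (X : mxfamily V) : mxfamily V :=
  fun n => [set x | forall Y : mxfamily V,
    matrix_convex Y -> (forall k, X k `<=` Y k) -> Y n x].

Arguments mxconv_hull {R V} X n _.

Definition real_structure (R : realType) (V : vectType R[i])
    (star : V -> V) : Prop :=
  linear_for (Num.conj \; *:%R) star /\ involutive star.

Definition starmx (R : realType) (V : vectType R[i]) (star : V -> V) (n : nat)
    (x : 'M[V]_n) : 'M[V]_n := map_mx star x^T.

Definition selfadjoint (R : realType) (V : vectType R[i]) (star : V -> V)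
    (n : nat) : set 'M[V]_n := [set x | x = starmx star x].

Arguments selfadjoint {R V} star n _.

(* Main.v *)
(* A matrix convex combination x = sum_i g_i^* y_i g_i gives the identity
   (x, 1) = sum_i (g_i^* y_i g_i, g_i^* g_i) in the real vector space
   M_n(V) + M_n(C)_sa, of dimension n^2 (2 dim V + 1), or in
   M_n(V)_sa + M_n(C)_sa, of dimension n^2 (dim V + 1), when the y_i are
   selfadjoint. By the conic form of Caratheodory's theorem, (x, 1) is a
   nonnegative combination, with coefficients c_i, of at most as many terms as
   this dimension, and sqrt(c_i) is absorbed by g_i: since the second component
   is preserved, the result is again a matrix convex combination. In the real
   case, V has a basis of selfadjoint vectors, with respect to which the
   coordinate matrices of a selfadjoint element of M_n(V) are hermitian. *)
Require Import Defs.
From mathcomp Require Import boolp spectral.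

Set Implicit Arguments.
Unset Strict Implicit.
Unset Printing Implicit Defensive.

Import Order.TTheory GRing.Theory Num.Theory.
Local Open Scope set_scope.
Local Open Scope ring_scope.
Local Open Scope sesquilinear_scope.

(** * Linear relations and the conic Caratheodory theorem *)

(** The rows indexed by [A] outnumber the columns, so their matrix has a nonzero vector in its left
    kernel; [d] extends this vector by zero off [A]. *)
Lemma nontrivial_relation (F : fieldType) (I T : finType) (f : I -> T -> F)
    (A : {set I}) :
  (#|T| < #|A|)%N ->
  exists d : I -> F, [/\ exists i, d i != 0, forall i, d i != 0 -> i \in A
    & forall t, \sum_i d i * f i t = 0].
Proof.
move=> TA; pose M := \matrix_(k < #|A|, l < #|T|) f (enum_val k) (enum_val l).
have /rowV0Pn[u /sub_kermxP uM u0] : kermx M != 0.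
  by rewrite kermx_eq0 /row_free neq_ltn (leq_ltn_trans (rank_leq_col M) TA).
have [k0 uk0] : exists k, u 0 k != 0 by apply/rV0Pn.
pose d i := \sum_k u 0 k *+ (enum_val k == i).
have dE k : d (enum_val k) = u 0 k.
  rewrite /d (bigD1 k) //= eqxx big1 ?addr0 // => l lk.
  by rewrite (inj_eq enum_val_inj) (negPf lk).
exists d; split=> [|i|t]; first by exists (enum_val k0); rewrite dE.
- apply: contraNT => iA; rewrite /d big1 // => k _.
  by case: eqP => // ki; rewrite -ki enum_valP in iA.
have /matrixP/(_ 0 (enum_rank t)) := uM; rewrite !mxE => uMt; rewrite -[RHS]uMt.
rewrite (bigID (mem A)) /= [X in _ + X]big1 ?addr0; last first.
  move=> i iA; rewrite /d big1 ?mul0r // => k _.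
  by case: eqP => // ki; rewrite -ki enum_valP in iA.
rewrite big_enum_val; apply: eq_bigr => k _.
by rewrite dE mxE enum_rankK.
Qed.

(** While the support of the coefficients is larger than [T], it carries a linear relation, and
    moving along this relation makes a coefficient vanish. The induction is on a bound for the
    support, for arbitrary nonnegative [c]; the lemma takes [c = 1]. *)
Lemma conic_caratheodory (F : realFieldType) (I T : finType) (f : I -> T -> F) :
  exists c : I -> F, [/\ forall i, 0 <= c i,
    (#|[pred i | c i != 0%R]| <= #|T|)%N
    & forall t, \sum_i c i * f i t = \sum_i f i t].
Proof.
suff H n (c : I -> F) : (#|[pred i | c i != 0%R]| <= n)%N ->
    (forall i, 0 <= c i) -> exists c' : I -> F, [/\ forall i, 0 <= c' i,
    (#|[pred i | c' i != 0%R]| <= #|T|)%N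
    & forall t, \sum_i c' i * f i t = \sum_i c i * f i t].
  have [//|c [c0 cT cE]] := H _ (fun=> 1) (leqnn _).
  by exists c; split=> // t; rewrite cE; apply: eq_bigr => i _; rewrite mul1r.
elim: n c => [|n IHn] c cn c_ge0.
  by exists c; split=> //; apply: leq_trans cn _.
have [cT|Tc] := leqP #|[pred i | c i != 0%R]| #|T|; first by exists c.
have [d [[i0 di0] dA dE]] : exists d : I -> F, [/\ exists i, 0 < d i,
    forall i, d i != 0 -> c i != 0 & forall t, \sum_i d i * f i t = 0].
  have [|d [[i0 di0] dA dE]] :=
    @nontrivial_relation _ _ _ f [set i | c i != 0]; first by rewrite cardsE.
  have dc i : d i != 0 -> c i != 0 by move/dA; rewrite inE.
  (* A relation can be negated, so it may be assumed to have a positive coefficient; the minimal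
     ratio below is then taken over a nonempty set. *)
  have [di0_gt0|di0_lt0|di0_eq0] := ltrgt0P (d i0).
  - by exists d; split=> //; exists i0.
  - exists (fun i => - d i); split=> [|i|t].
    + by exists i0; rewrite oppr_gt0.
    + by rewrite oppr_eq0 => /dc.
    + by under eq_bigr do rewrite mulNr; rewrite sumrN dE oppr0.
  - by rewrite di0_eq0 eqxx in di0.
(* Subtract the largest multiple of d that keeps all the coefficients
   nonnegative: a coefficient with minimal ratio vanishes. *)
case: (@arg_minP _ _ _ i0 (fun i => 0 < d i) (fun i => c i / d i)) => //.
move=> i1 di1 le_i1.
pose c' i := c i - c i1 / d i1 * d i.
have [||c'' [c''_ge0 c''T c''E]] := IHn c'.
- rewrite -ltnS; apply: leq_trans cn; apply: proper_card; apply/properP; split.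
    apply/fintype.subsetP => i; rewrite !inE; apply: contraNneq => ci.
    rewrite /c'.
    have -> : d i = 0 by apply/eqP; apply: contraTT isT => /dA; rewrite ci eqxx.
    by rewrite mulr0 ci subr0.
  exists i1; first by rewrite inE dA ?gt_eqF.
  rewrite inE negbK /c' divfK ?(gt_eqF di1) ?subrr //.
- move=> i; rewrite subr_ge0; have [di|di] := ltP 0 (d i).
    by rewrite -ler_pdivlMr ?le_i1.
  apply: le_trans (c_ge0 i); rewrite mulr_ge0_le0 // divr_ge0 ?c_ge0 //.
  exact: ltW.
exists c''; split=> // t; rewrite c''E.
under eq_bigr do rewrite mulrBl -(mulrA (c i1 / d i1)).
by rewrite sumrB -mulr_sumr dE mulr0 subr0.
Qed.

(** Vectors already in the span of those kept are dropped. Since [b] is drawn from [s], it inherits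
    selfadjointness when [s] consists of selfadjoint vectors. *)
Lemma free_span_sub (K : fieldType) (vT : vectType K) (s : seq vT) :
  exists b, [/\ {subset b <= s}, free b & <<b>>%VS = <<s>>%VS].
Proof.
elim: s => [|v s [b [bs fb sb]]]; first by exists [::]; rewrite nil_free.
have [vs|vs] := boolP (v \in <<s>>%VS).
  exists b; split=> // [w /bs ws|]; first by rewrite inE ws orbT.
  by rewrite span_cons sb; apply/esym/addv_idPr; rewrite -memvE.
exists (v :: b); split.
- by move=> w; rewrite !inE => /orP[->//|/bs ->]; rewrite orbT.
- by rewrite free_cons sb vs.
- by rewrite !span_cons sb.
Qed.

(** * Algebra of compressions *)

Section MatrixCombinations.
Context {R : realType} {V : vectType R[i]}.
Implicit Types (X : mxfamily V) (star : V -> V) (c : R).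

Lemma compressE m n (g : 'M[R[i]]_(m, n)) (x : 'M[V]_m) i j :
  compress g x i j = \sum_k \sum_l ((g l i)^* * g k j) *: x l k.
Proof.
rewrite !mxE; apply: eq_bigr => k _; rewrite mxE scaler_sumr.
by apply: eq_bigr => l _; rewrite !mxE scalerA mulrC.
Qed.

Lemma compress_sum m n (g : 'M[R[i]]_(m, n)) (I : finType) (x : I -> 'M[V]_m) :
  compress g (\sum_i x i) = \sum_i compress g (x i).
Proof.
apply/matrixP => a b; rewrite compressE summxE.
under [RHS]eq_bigr do rewrite compressE.
rewrite [RHS]exchange_big /=; apply: eq_bigr => k _.
rewrite [RHS]exchange_big /=; apply: eq_bigr => l _.
by rewrite summxE scaler_sumr.
Qed.

Lemma compress1 n (x : 'M[V]_n) : compress 1%:M x = x.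
Proof.
apply/matrixP => i j; rewrite compressE (bigD1 j) //= [X in _ + X]big1 ?addr0.
  rewrite (bigD1 i) //= big1 ?addr0 => [|l li].
    by rewrite !mxE !eqxx rmorph1 mulr1 scale1r.
  by rewrite !mxE (negPf li) rmorph0 mul0r scale0r.
move=> k kj; rewrite big1 // => l _.
by rewrite !mxE (negPf kj) mulr0 scale0r.
Qed.

Lemma lmulmxvA m n p q (A : 'M[R[i]]_(m, n)) (B : 'M[R[i]]_(n, p))
    (x : 'M[V]_(p, q)) :
  lmulmxv (A *m B) x = lmulmxv A (lmulmxv B x).
Proof.
apply/matrixP => i j; rewrite !mxE.
under eq_bigr do rewrite mxE scaler_suml.
rewrite exchange_big /=; apply: eq_bigr => l _.
by rewrite mxE scaler_sumr; apply: eq_bigr => k _; rewrite scalerA.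
Qed.

Lemma rmulmxvA m n p q (x : 'M[V]_(m, n)) (A : 'M[R[i]]_(n, p))
    (B : 'M[R[i]]_(p, q)) :
  rmulmxv x (A *m B) = rmulmxv (rmulmxv x A) B.
Proof.
apply/matrixP => i j; rewrite !mxE.
under eq_bigr do rewrite mxE scaler_suml.
rewrite exchange_big /=; apply: eq_bigr => l _.
rewrite mxE scaler_sumr; apply: eq_bigr => k _.
by rewrite scalerA mulrC.
Qed.

Lemma lmulmxv_rmulmxv m n p q (A : 'M[R[i]]_(m, n)) (x : 'M[V]_(n, p))
    (B : 'M[R[i]]_(p, q)) :
  lmulmxv A (rmulmxv x B) = rmulmxv (lmulmxv A x) B.
Proof.
apply/matrixP => i j; rewrite !mxE.
under eq_bigr do rewrite mxE scaler_sumr.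
rewrite exchange_big /=; apply: eq_bigr => l _.
rewrite mxE scaler_sumr; apply: eq_bigr => k _.
by rewrite !scalerA mulrC.
Qed.

Lemma compress_mul m n p (h : 'M[R[i]]_(m, n)) (g : 'M[R[i]]_(n, p))
    (x : 'M[V]_m) :
  compress (h *m g) x = compress g (compress h x).
Proof.
by rewrite /compress lmulmxv_rmulmxv -rmulmxvA -lmulmxvA trmx_mul map_mxM.
Qed.

Lemma conj_realC c : (c%:C%C : R[i])^* = c%:C%C.
Proof. exact: conjc_real. Qed.

(** The real scalars act on matrices over [V] through their embedding in [R[i]]. *)
Definition rscale n c (x : 'M[V]_n) : 'M[V]_n :=
  map_mx (fun v => c%:C%C *: v) x.

Lemma compressZ m n c (g : 'M[R[i]]_(m, n)) (x : 'M[V]_m) :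
  compress (c%:C%C *: g) x = rscale (c ^+ 2) (compress g x).
Proof.
apply/matrixP => i j; rewrite [in RHS]mxE !compressE scaler_sumr.
apply: eq_bigr => k _; rewrite scaler_sumr; apply: eq_bigr => l _.
by rewrite !mxE scalerA rmorphM /= conj_realC mulrACA expr2 rmorphM.
Qed.

(** * Matrix convex combinations and the hull *)

(** Allows index sets other than ['I_s]: dependent pairs when combinations are nested, and the
    support of the coefficients after reduction. *)
Lemma mxconv_comb_in X (I : finType) (A : {pred I}) n (x : 'M[V]_n.+1)
    (m : I -> nat) (y : forall i, 'M[V]_((m i).+1))
    (g : forall i, 'M[R[i]]_((m i).+1, n.+1)) :
  (forall i, X (m i) (y i)) ->
  \sum_(i in A) (g i) ^t* *m g i = 1%:M ->
  x = \sum_(i in A) compress (g i) (y i) ->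
  mxconv_comb X #|A| x.
Proof.
move=> Xy g1 xE.
exists (fun k => m (enum_val k)), (fun k => y (enum_val k)).
exists (fun k => g (enum_val k)); split=> //.
- by rewrite -g1 [RHS]big_enum_val.
- by rewrite xE big_enum_val.
Qed.

(** The combinations of points of [X] form a matrix convex family containing [X], so the hull lies
    in it. Nested combinations compose with weights [g' i j *m g i]. *)
Lemma mxconv_hull_comb X n (x : 'M[V]_n.+1) :
  mxconv_hull X n x -> exists s, mxconv_comb X s x.
Proof.
pose Y : mxfamily V := fun n x => exists s, mxconv_comb X s x.
move=> /(_ Y); apply; last first.
  move=> k z Xz; exists #|'I_1|.
  apply: (@mxconv_comb_in X 'I_1 predT k z (fun=> k) (fun=> z) (fun=> 1%:M)) => //.
    by rewrite big_ord1 mulmx1 trmx1 map_mx1.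
  by rewrite big_ord1 compress1.
move=> s {}n {}x [m [y [g [Yy g1 ->]]]].
(* Choice fixes one representation for every [y i]. The lengths [t i] vary with [i], hence the
   dependent pairs as indices. *)
have [t [m' [y' [g' Hg']]]] : exists (t : 'I_s -> nat)
    (m' : forall i, 'I_(t i) -> nat)
    (y' : forall i j, 'M[V]_((m' i j).+1))
    (g' : forall i j, 'M[R[i]]_((m' i j).+1, (m i).+1)),
    forall i, [/\ forall j, X (m' i j) (y' i j),
      \sum_j (g' i j) ^t* *m g' i j = 1%:M
      & y i = \sum_j compress (g' i j) (y' i j)].
  pose W i := cid (Yy i).
  pose W1 i := cid (projT2 (W i)).
  pose W2 i := cid (projT2 (W1 i)).
  pose W3 i := cid (projT2 (W2 i)).
  exists (fun i => projT1 (W i)), (fun i => projT1 (W1 i)).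
  exists (fun i => projT1 (W2 i)), (fun i => projT1 (W3 i)) => i.
  exact: projT2 (W3 i).
exists #|{: {i : 'I_s & 'I_(t i)}}|.
apply: (@mxconv_comb_in X {i : 'I_s & 'I_(t i)} predT n _
  (fun p => m' (tag p) (tagged p)) (fun p => y' (tag p) (tagged p))
  (fun p => g' (tag p) (tagged p) *m g (tag p))).
- by move=> p; have [] := Hg' (tag p).
- rewrite -g1 -(sig_big_dep xpredT (fun=> xpredT)
    (fun i j => (g' i j *m g i)^t* *m (g' i j *m g i))) /=.
  apply: eq_bigr => i _; have [_ g'1 _] := Hg' i.
  (* The inner unit sum is inserted between the adjoint of [g i] and [g i]. *)
  rewrite -[X in _ = _ *m X]mul1mx -g'1 mulmx_suml mulmx_sumr.
  apply: eq_bigr => j _.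
  by rewrite trmx_mul map_mxM -!mulmxA.
- rewrite -(sig_big_dep xpredT (fun=> xpredT)
    (fun i j => compress (g' i j *m g i) (y' i j))) /=.
  apply: eq_bigr => i _; have [_ _ ->] := Hg' i.
  by rewrite compress_sum; apply: eq_bigr => j _; rewrite compress_mul.
Qed.

(** * Real coordinates of hermitian matrices and the length bound *)

(* A hermitian matrix is determined by the real parts of its entries on and above
   the diagonal and the imaginary parts of its entries strictly below it: this
   indexes n^2 real coordinates by the positions of the entries. *)
Definition hermitian_coord n (h : 'M[R[i]]_n) (p : 'I_n * 'I_n) : R :=
  if (p.1 <= p.2)%N then complex.Re (h p.1 p.2) else complex.Im (h p.1 p.2).

Lemma hermitian_coord_inj n (h h' : 'M[R[i]]_n) : h ^t* = h -> h' ^t* = h' ->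
  hermitian_coord h =1 hermitian_coord h' -> h = h'.
Proof.
have hE (k : 'M[R[i]]_n) i j : k ^t* = k -> k i j = (k j i)^*.
  by move=> /matrixP/(_ i j); rewrite !mxE.
move=> hh hh' E.
have Eij (i j : 'I_n) : (i <= j)%N -> h i j = h' i j.
  move=> ij; have := E (i, j); rewrite /hermitian_coord /= ij.
  (* On the diagonal, hermitian symmetry forces the imaginary part to equal its opposite, hence to
     vanish. Above it, the imaginary part is recovered, up to sign, from the mirrored position
     [(j, i)]. *)
  have [/val_inj ij'|ij'] := eqVneq (i : nat) j.
    have := hE h i j hh; have := hE h' i j hh'; rewrite -ij'.
    case: (h i i) (h' i i) => [a b] [a' b'] [b'0] [b0] /= ->.
    have e0 (u : R) : u = - u -> u = 0.
      by move=> /eqP; rewrite -addr_eq0 -mulr2n mulrn_eq0 => /eqP.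
    by rewrite (e0 _ b0) (e0 _ b'0).
  have := E (j, i); rewrite /hermitian_coord /= leqNgt ltn_neqAle ij' ij /=.
  rewrite (hE h j i hh) (hE h' j i hh').
  by case: (h i j) (h' i j) => [a b] [a' b'] /= /oppr_inj -> ->.
apply/matrixP => i j; have [/Eij//|/ltnW ji] := leqP i j.
by rewrite (hE h) // (hE h') // Eij.
Qed.

Lemma Re_sum (I : finType) (c : I -> R) (z : I -> R[i]) :
  complex.Re (\sum_i (c i)%:C%C * z i) = \sum_i c i * complex.Re (z i).
Proof.
rewrite (big_morph (@complex.Re R) (id1 := 0) (op1 := +%R)) //; last first.
  by case=> ? ? [].
by apply: eq_bigr => i _; case: (z i) => a b /=; rewrite mul0r subr0.
Qed.

Lemma Im_sum (I : finType) (c : I -> R) (z : I -> R[i]) :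
  complex.Im (\sum_i (c i)%:C%C * z i) = \sum_i c i * complex.Im (z i).
Proof.
rewrite (big_morph (@complex.Im R) (id1 := 0) (op1 := +%R)) //; last first.
  by case=> ? ? [].
by apply: eq_bigr => i _; case: (z i) => a b /=; rewrite mul0r addr0.
Qed.

Lemma hermitian_coord_sum (I : finType) (c : I -> R) n (h : I -> 'M[R[i]]_n) p :
  hermitian_coord (\sum_i (c i)%:C%C *: h i) p =
  \sum_i c i * hermitian_coord (h i) p.
Proof.
rewrite /hermitian_coord; case: ifP => _; rewrite summxE -?Re_sum -?Im_sum.
  by congr complex.Re; apply: eq_bigr => i _; rewrite mxE.
by congr complex.Im; apply: eq_bigr => i _; rewrite mxE.
Qed.

Lemma gram_hermitian m n (g : 'M[R[i]]_(m, n)) : (g ^t* *m g) ^t* = g ^t* *m g.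
Proof. by rewrite trmx_mul map_mxM trmxCK. Qed.

(* F is a system of real coordinates on the real subspace S. The coordinates of
   the gram matrices account for the summand n^2, which keeps the combinations
   unital. *)
Lemma mxconv_comb_bound X s n (x : 'M[V]_n.+1) (T : finType)
    (F : 'M[V]_n.+1 -> T -> R) (S : 'M[V]_n.+1 -> Prop) :
  (forall m (g : 'M[R[i]]_(m.+1, n.+1)) y, X m y -> S (compress g y)) ->
  (forall (I : finType) (c : I -> R) z, (forall i, S (z i)) ->
    S (\sum_i rscale (c i) (z i))) ->
  (forall (I : finType) (c : I -> R) z t,
    F (\sum_i rscale (c i) (z i)) t = \sum_i c i * F (z i) t) ->
  (forall z z', S z -> S z' -> F z =1 F z' -> z = z') ->
  mxconv_comb X s x ->
  exists2 s', (s' <= n.+1 ^ 2 + #|T|)%N & mxconv_comb X s' x.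
Proof.
move=> SX Ssum Fsum Finj [m [y [g [Xy g1 xE]]]].
pose z i := compress (g i) (y i).
pose h i := (g i)^t* *m g i.
have Sz i : S (z i) by apply: SX.
have z1 : \sum_i rscale 1 (z i) = \sum_i z i.
  by apply: eq_bigr => i _; apply/matrixP => a b; rewrite mxE scale1r.
(* The disjoint sum of index types concatenates both coordinate systems, so that one [c] preserves
   the unit and [x] together. *)
have [c [c_ge0 cT cE]] := @conic_caratheodory R 'I_s ('I_n.+1 * 'I_n.+1 + T)%type
  (fun i t => match t with inl p => hermitian_coord (h i) p
                         | inr t => F (z i) t end).
have cg1 : \sum_i (c i)%:C%C *: h i = 1%:M.
  apply: hermitian_coord_inj.
  - rewrite raddf_sum raddf_sum; apply: eq_bigr => i _ /=.
    by rewrite linearZ map_mxZ /= gram_hermitian conj_realC.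
  - by rewrite trmx1 map_mx1.
  - move=> p; rewrite hermitian_coord_sum (cE (inl p)) -g1.
    transitivity (\sum_i 1 * hermitian_coord (h i) p).
      by apply: eq_bigr => i _; rewrite mul1r.
    rewrite -hermitian_coord_sum; congr hermitian_coord.
    by apply: eq_bigr => i _; rewrite scale1r.
have cx : \sum_i rscale (c i) (z i) = x.
  rewrite xE -z1; apply: Finj; [exact: Ssum|exact: Ssum|] => t.
  rewrite !Fsum (cE (inr t)).
  by apply: eq_bigr => i _; rewrite mul1r.
exists #|[pred i | c i != 0%R]|.
  by rewrite (leq_trans cT) // card_sum card_prod !card_ord.
apply: (@mxconv_comb_in X _ _ n x m y
  (fun i => (Num.sqrt (c i))%:C%C *: g i)) => //.
(* Terms with zero coefficient are discarded; on the others the factor [Num.sqrt (c i)] enters twice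
   and gives back [c i]. *)
- rewrite -cg1 [RHS](bigID (fun i => c i != 0)) /=.
  rewrite [X in _ = _ + X]big1 ?addr0; last first.
    by move=> i; rewrite negbK => /eqP ->; rewrite scale0r.
  apply: eq_big => [i|i _]; first by rewrite inE.
  rewrite -scalemxAr [_^T]linearZ map_mxZ /= -scalemxAl scalerA conj_realC.
  by rewrite -rmorphM -expr2 sqr_sqrtr.
- rewrite -cx [LHS](bigID (fun i => c i != 0)) /=.
  rewrite [X in _ + X = _]big1 ?addr0; last first.
    move=> i; rewrite negbK => /eqP ->.
    by apply/matrixP => a b; rewrite !mxE scale0r.
  apply: eq_big => [i|i _]; first by rewrite inE.
  by rewrite compressZ sqr_sqrtr.
Qed.

(** * Coordinate matrices over a basis of [V] *)

Definition coordmx d (b : d.-tuple V) (k : 'I_d) n (z : 'M[V]_n) : 'M[R[i]]_n :=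
  map_mx (coord b k) z.

Lemma coordmx_sum d (b : d.-tuple V) k (I : finType) (c : I -> R) n
    (z : I -> 'M[V]_n) :
  coordmx b k (\sum_i rscale (c i) (z i)) =
  \sum_i (c i)%:C%C *: coordmx b k (z i).
Proof.
apply/matrixP => a a'; rewrite mxE !summxE linear_sum.
by apply: eq_bigr => i _; rewrite !mxE linearZ.
Qed.

Lemma coordmx_inj d (b : d.-tuple V) n (z z' : 'M[V]_n) :
  basis_of fullv b -> (forall k, coordmx b k z = coordmx b k z') -> z = z'.
Proof.
move=> bV E; apply/matrixP => i j.
rewrite (coord_basis bV (memvf (z i j))) (coord_basis bV (memvf (z' i j))).
by apply: eq_bigr => k _; have /matrixP/(_ i j) := E k; rewrite !mxE => ->.
Qed.

(** * Selfadjoint bases and hermitian coordinates *)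

Section RealStructure.
Variables (star : V -> V) (starP : real_structure star).

Lemma starZD a u v : star (a *: u + v) = a^* *: star u + star v.
Proof. by case: starP => /(_ a u v). Qed.

Lemma star0 : star 0 = 0.
Proof.
have := starZD (-1) 0 0; rewrite scaler0 addr0 rmorphN1 scaleN1r.
by rewrite addNr.
Qed.

Lemma starD u v : star (u + v) = star u + star v.
Proof. by have := starZD 1 u v; rewrite rmorph1 !scale1r. Qed.

Lemma starZ a u : star (a *: u) = a^* *: star u.
Proof. by have := starZD a u 0; rewrite star0 !addr0. Qed.

Lemma starK : involutive star.
Proof. by have [] := starP. Qed.

Lemma star_sum (I : finType) (v : I -> V) :
  star (\sum_i v i) = \sum_i star (v i).
Proof. by rewrite (big_morph star starD star0). Qed.

(** The vectors [p v] and [q v] below are selfadjoint, and [v] is half of [p v + J^-1 *: q v].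
    Applied to any basis they therefore span, and a basis can be extracted from them. *)
Lemma selfadjoint_basis : exists b : (\dim {: V}).-tuple V,
  basis_of fullv b /\ forall k : 'I_(\dim {: V}), star b`_k = b`_k.
Proof.
pose J : R[i] := 'i; have J0 : J != 0 by apply: neq0Ci.
have JJ : J^* = - J by apply: conjCi.
pose p v := v + star v; pose q v := J *: (v - star v).
have starp v : star (p v) = p v by rewrite starD starK addrC.
have starq v : star (q v) = q v.
  rewrite starZ starD -scaleN1r starZ rmorphN1 starK JJ scaleN1r scaleNr.
  by rewrite -scalerN opprB.
pose s := map p (vbasis {: V}) ++ map q (vbasis {: V}).
have [b [bs fb sb]] := free_span_sub s.
have bV : basis_of fullv b.
  rewrite basisEfree fb subvf /=.
  have : (fullv <= <<b>>)%VS.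
    rewrite -(span_basis (vbasisP {: V})); apply/span_subvP => v vV.
    have ps : p v \in <<s>>%VS.
      by apply: memv_span; rewrite mem_cat map_f.
    have qs : q v \in <<s>>%VS.
      by apply: memv_span; rewrite mem_cat [X in _ || X]map_f ?orbT.
    rewrite sb; have -> : v = 2^-1 *: (p v + J^-1 *: q v).
      rewrite /p /q scalerA mulVf // scale1r addrACA subrr addr0.
      by rewrite -mulr2n -(scaler_nat 2 v) scalerA mulVf ?scale1r ?pnatr_eq0.
    by rewrite memvZ // memvD // memvZ.
  by move/dimvS; rewrite (eqP fb).
have szb : size b == \dim {: V} by rewrite -(eqP fb) (span_basis bV).
exists (Tuple szb); split=> // k /=.
have : b`_k \in s by apply: bs; rewrite mem_nth // (eqP szb).
by rewrite mem_cat => /orP[] /mapP[v _ ->].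
Qed.

Lemma starmx_compress m n (g : 'M[R[i]]_(m, n)) (y : 'M[V]_m) :
  starmx star (compress g y) = compress g (starmx star y).
Proof.
apply/matrixP => i j; rewrite [LHS]mxE [X in star X]mxE !compressE star_sum.
under eq_bigr do rewrite star_sum.
rewrite exchange_big /=; apply: eq_bigr => k _; apply: eq_bigr => l _.
by rewrite starZ !mxE rmorphM /= conjCK mulrC.
Qed.

Lemma starmx_sum (I : finType) (c : I -> R) n (z : I -> 'M[V]_n) :
  starmx star (\sum_i rscale (c i) (z i)) =
  \sum_i rscale (c i) (starmx star (z i)).
Proof.
apply/matrixP => a b; rewrite !mxE !summxE star_sum.
by apply: eq_bigr => i _; rewrite !mxE starZ conj_realC.
Qed.

(** Over a selfadjoint basis, [star] conjugates the coordinates of a vector, by their uniqueness. *)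
Lemma coordmx_hermitian d (b : d.-tuple V) n (z : 'M[V]_n) k :
  basis_of fullv b -> (forall k : 'I_d, star b`_k = b`_k) ->
  starmx star z = z -> (coordmx b k z)^t* = coordmx b k z.
Proof.
move=> bV sb /matrixP sz; apply/matrixP => i j; rewrite !mxE.
rewrite -[in RHS](sz i j) !mxE [in RHS](coord_basis bV (memvf (z j i))) star_sum.
under eq_bigr do rewrite starZ sb.
by rewrite coord_sum_free ?(basis_free bV).
Qed.

End RealStructure.

End MatrixCombinations.

Local Open Scope classical_set_scope.
Local Open Scope ring_scope.

(** * The two length bounds *)

Theorem theorem2p3 (R : realType) (V : vectType R[i]) (X : mxfamily V) :
  (forall (n : nat) (x : 'M[V]_n.+1), mxconv_hull X n x ->
     exists2 s : nat, (s <= n.+1 ^ 2 * (2 * \dim {: V} + 1))%N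
                    & mxconv_comb X s x)
  /\
  (forall star : V -> V, real_structure star ->
     (forall n : nat, X n `<=` selfadjoint star n.+1) ->
     forall (n : nat) (x : 'M[V]_n.+1), mxconv_hull X n x ->
       exists2 s : nat, (s <= n.+1 ^ 2 * (\dim {: V} + 1))%N
                      & mxconv_comb X s x).
Proof.
split=> [n x|star starP Xsa n x] /mxconv_hull_comb[s xs].
  (* Each of the complex coordinates of an entry counts for two reals, its real and imaginary parts;
     no subspace is imposed, so [S] is [True]. *)
  pose T := (bool * 'I_(\dim {: V}) * ('I_n.+1 * 'I_n.+1))%type.
  pose F (z : 'M[V]_n.+1) (t : T) := let: (re, k, (i, j)) := t in
    let w := coordmx (vbasis {: V}) k z i j in
    if re then complex.Re w else complex.Im w.
  have [//|//|||s' s'T Xs'] := @mxconv_comb_bound R V X s n x T F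
    (fun=> True) _ _ _ _ xs.
  - move=> I c z [[re k] [i j]]; rewrite /F /= coordmx_sum summxE.
    case: re; rewrite -?Re_sum -?Im_sum.
      by congr complex.Re; apply: eq_bigr => l _; rewrite mxE.
    by congr complex.Im; apply: eq_bigr => l _; rewrite mxE.
  - move=> z z' _ _ zz'; apply: (coordmx_inj (vbasisP _)) => k.
    apply/matrixP => i j; apply/eqP; rewrite eq_complex.
    have := zz' (true, k, (i, j)); have := zz' (false, k, (i, j)).
    by rewrite /F /= => -> ->; rewrite !eqxx.
  exists s' => //; apply: leq_trans s'T _.
  by rewrite !card_prod card_bool !card_ord mulnDr muln1 addnC mulnC.
(* Here [S] is selfadjointness: each basis vector contributes one hermitian matrix, hence [n.+1 ^ 2]
   real coordinates instead of twice as many. *)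
have [b [bV sb]] := selfadjoint_basis starP.
pose T := ('I_(\dim {: V}) * ('I_n.+1 * 'I_n.+1))%type.
pose F (z : 'M[V]_n.+1) (t : T) := hermitian_coord (coordmx b t.1 z) t.2.
have [||||s' s'T Xs'] := @mxconv_comb_bound R V X s n x T F
  (fun z => starmx star z = z) _ _ _ _ xs.
- move=> m g y /Xsa /= ysa; by rewrite (starmx_compress starP) -ysa.
- move=> I c z zsa; rewrite (starmx_sum starP).
  by apply: eq_bigr => i _; rewrite zsa.
- by move=> I c z t; rewrite /F coordmx_sum hermitian_coord_sum.
- move=> z z' zsa z'sa zz'; apply: (coordmx_inj bV) => k.
  apply: hermitian_coord_inj => [||p]; last exact: (zz' (k, p)).
  - exact: (coordmx_hermitian starP).
  - exact: (coordmx_hermitian starP).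
exists s' => //; apply: leq_trans s'T _.
by rewrite !card_prod !card_ord mulnDr muln1 addnC mulnC.
Qed.
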